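(* In univalent type theory: assume given some $t:\mathtt{Prop}\rightarrow\mathtt{Prop}\rightarrow\mathtt{Prop}$ and inhabitants of the following types: (1) $\Pi(P\;Q:\mathtt{Prop}).\ ((P\Rightarrow\bot)\Rightarrow Q)\Rightarrow((Q\Rightarrow\bot)\Rightarrow P)\Rightarrow(t\,P\,Q\Rightarrow\bot)\Rightarrow P$, and (2) $\Pi(P\;Q:\mathtt{Prop}).\ ((P\Rightarrow\bot)\Rightarrow Q)\Rightarrow((Q\Rightarrow\bot)\Rightarrow P)\Rightarrow((t\,P\,Q\Rightarrow\bot)\Rightarrow\bot)\Rightarrow Q$. Then one can construct an inhabitant of the type $\Pi P:\mathtt{Prop}.\ ((P\Rightarrow\bot)\Rightarrow\bot)\Rightarrow P$.
   Context: Propositions are the h-propositions (types with at most one inhabitant); $\mathtt{Prop}$ is the type of all propositions (in a fixed universe), $\bot$ is the false proposition and $\Rightarrow$ is implication of propositions. As in univalent type theories (e.g. the conventions of the HoTT Book), propositional extensionality holds: logically equivalent propositions are equal. No classical axioms are assumed. *)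

(* Defs.v *)
Definition isProp (A : Type) : Type := forall x y : A, x = y.

(** Rocq's sort [Prop] is not used to interpret propositions: a proposition
    is an arbitrary type with at most one inhabitant. *)
Record hProp : Type := HProp {
  carrier :> Type;
  carrier_isProp : isProp carrier
}.

Definition bot : hProp :=
  HProp False (fun x _ => match x with end).

(** The implication of [P Q : hProp] is the function type [P -> Q], with both
    sides coerced to types; it is again an h-proposition by [FunExt]. *)

(** The two consequences of univalence that hold in the ambient theory,
    to be taken as hypotheses. *)
Definition FunExt : Type :=
  forall (A : Type) (B : A -> Type) (f g : forall x : A, B x),
    (forall x : A, f x = g x) -> f = g.

Definition PropExt : Type :=
  forall P Q : hProp, (P -> Q) -> (Q -> P) -> P = Q.

(* Main.v *)
Require Import Defs.

(** Let [T] be [t top top], and let [R] satisfy [~ ~ R]. Under a double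
    negation [R] may be replaced by [top], so negated facts about [t R _] can be
    computed as if [R] were [top].

    First, [~ ~ T] implies [R]: then [t R R] is doubly negated, and (2) at
    the pair [(R, R)] gives [R].

    Now consider the pair [(R, ~ T)]. It satisfies the premises of (1): [~ R] is
    absurd, and [~ ~ T] implies [R] by the first step. Moreover [t R (~ T)] is
    false. By extensionality it may be computed assuming [R] and either [T]
    or [~ T]: if [T] holds it is [t R bot], which (2) refutes because it
    would prove [bot]; if [~ T] holds it is [t top top], that is [T]. So (1)
    yields [R]. The point of the second component is that neither [~ T] nor
    [~ ~ T] has to be decided. *)

Definition top : hProp :=
  HProp True (fun x y =>
    match x, y with I, I => eq_refl end).

Definition neg (funext : FunExt) (P : hProp) : hProp :=
  HProp (P -> bot)
    (fun f g => funext P (fun _ => bot) f g (fun x => match f x with end)).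

Lemma inhabited_eq_top (propext : PropExt) (P : hProp) (p : P) : P = top.
Proof. exact (propext P top (fun _ => I) (fun _ => p)). Qed.

Lemma refuted_eq_bot (propext : PropExt) (P : hProp) (np : P -> bot) : P = bot.
Proof. exact (propext P bot np (fun x => match x with end)). Qed.

(** Applied to the diagonal pair [(R, R)], where either (1) or (2) would
    conclude [R], the double negation of [t top top] selects (2). *)
Lemma nn_diagonal_stable (propext : PropExt) (t : hProp -> hProp -> hProp)
  (H2 : forall P Q : hProp,
      ((P -> bot) -> Q) -> ((Q -> bot) -> P) -> ((t P Q -> bot) -> bot) -> Q)
  (R : hProp) (nnR : (R -> bot) -> bot) :
  ((t top top -> bot) -> bot) -> R.
Proof.
  intros nnT.
  apply (H2 R R).
  - intros nR; destruct (nnR nR).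
  - intros nR; destruct (nnR nR).
  - intros nt; apply nnR; intros r; apply nnT; intros x; apply nt.
    rewrite (inhabited_eq_top propext R r); exact x.
Qed.

(** Assuming [R], a proof of [t R (~ T)] refutes [T], since under [T] it would
    be a proof of [t R bot]; but then [~ T] is [top], and the same proof is
    one of [T]. *)
Lemma not_t_neg_diagonal (funext : FunExt) (propext : PropExt)
  (t : hProp -> hProp -> hProp)
  (H2 : forall P Q : hProp,
      ((P -> bot) -> Q) -> ((Q -> bot) -> P) -> ((t P Q -> bot) -> bot) -> Q)
  (R : hProp) (nnR : (R -> bot) -> bot) :
  t R (neg funext (t top top)) -> bot.
Proof.
  intros x; apply nnR; intros r.
  assert (nT : t top top -> bot).
  { intros y.
    rewrite (refuted_eq_bot propext (neg funext (t top top))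
               (fun n => n y)) in x.
    exact (H2 R bot (fun nR => nR r) (fun _ => r) (fun nt => nt x)). }
  apply nT.
  rewrite (inhabited_eq_top propext (neg funext (t top top)) nT) in x.
  rewrite (inhabited_eq_top propext R r) in x.
  exact x.
Qed.

Theorem proposition3p30
  (funext : FunExt)
  (propext : PropExt)
  (t : hProp -> hProp -> hProp)
  (H1 : forall P Q : hProp,
      ((P -> bot) -> Q) -> ((Q -> bot) -> P) -> (t P Q -> bot) -> P)
  (H2 : forall P Q : hProp,
      ((P -> bot) -> Q) -> ((Q -> bot) -> P) -> ((t P Q -> bot) -> bot) -> Q) :
  forall P : hProp, ((P -> bot) -> bot) -> P.
Proof.
  intros R nnR.
  apply (H1 R (neg funext (t top top))).
  - intros nR; destruct (nnR nR).
  - exact (nn_diagonal_stable propext t H2 R nnR).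
  - exact (not_t_neg_diagonal funext propext t H2 R nnR).
Qed.
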